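(* Let $(X,d,A)$ be a metric pair, let $\rho$ be the Grothendieck metric on the group $K(X,A)$ of virtual persistence diagrams, and let $d_1$ be the $1$-strengthened metric on $X/A$. The following are equivalent: (i) $(K(X,A),\rho)$ is locally compact; (ii) $(K(X,A),\rho)$ is discrete; (iii) $(X/A,d_1,[A])$ is uniformly discrete.
   Context: A metric pair $(X,d,A)$ is a metric space $(X,d)$ with a distinguished subset $A\subseteq X$. Put $d(x,A):=\inf_{a\in A}d(x,a)$ and define the $1$-strengthened metric $d_1(x,y):=\min\bigl(d(x,y),\,d(x,A)+d(y,A)\bigr)$ for $x,y\in X$. Let $X/A$ be the quotient collapsing $A$ to one point $[A]$; $d_1$ descends to $X/A$ (with $d_1(x,[A])=d(x,A)$). Standing assumption: $A$ is nonempty and the descended $d_1$ is a genuine (separated) metric on $X/A$, i.e. $d(x,A)>0$ for every $x\in X\setminus A$. For a set $Y$, $D(Y)$ is the free commutative monoid on $Y$ (finite multisets). $D(X,A):=D(X)/D(A)$ is the commutative monoid of finite persistence diagrams; it is the free commutative monoid on $X\setminus A$. For $\alpha,\beta\in D(X,A)$, a matching between $\alpha$ and $\beta$ is an element $\sigma\in D(X\times X)$ whose first and second marginals agree with $\alpha$ and $\beta$ respectively modulo $D(A)$, and $W_1(\alpha,\beta):=\inf_\sigma\sum_{(x,y)\in\sigma}d_1(x,y)$, the infimum being over all such matchings (sum with multiplicity). $K(X,A)$ is the Grothendieck group of $D(X,A)$; its elements are formal differences $\alpha-\beta$ with $\alpha,\beta\in D(X,A)$. The Grothendieck metric is $\rho(\alpha-\beta,\gamma-\delta):=W_1(\alpha+\delta,\gamma+\beta)$,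 which is a well-defined translation-invariant metric on $K(X,A)$ extending $W_1$. Local compactness and discreteness refer to the metric topology of $\rho$. A metric space $(Y,m)$ is uniformly discrete if there is $\varepsilon>0$ with $m(u,v)\ge\varepsilon$ for all distinct $u,v\in Y$. *)

(* Defs.v *)
From HB Require Import structures.
From mathcomp Require Import all_boot all_order all_algebra.
From mathcomp Require Import finmap multiset.
From mathcomp Require Import all_classical all_reals all_analysis.
From mathcomp Require Import lra.

Set Implicit Arguments.
Unset Strict Implicit.
Unset Printing Implicit Defensive.

Import Order.TTheory GRing.Theory Num.Theory.

Local Open Scope classical_set_scope.
Local Open Scope ring_scope.
Local Open Scope quotient_scope.

Section Grothendieck.
Context {M : nmodType}.
Implicit Types p q : M * M.

Definition grothendieck_rel p q : bool :=
  `[< exists k, p.1 + q.2 + k = q.1 + p.2 + k >].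

Lemma grothendieck_rel_refl : reflexive grothendieck_rel.
Proof. by move=> p; apply/asboolP; exists 0. Qed.

Lemma grothendieck_rel_sym : symmetric grothendieck_rel.
Proof. by move=> p q; apply/asboolP/asboolP => -[k kE]; exists k. Qed.

Lemma grothendieck_rel_trans : transitive grothendieck_rel.
Proof.
move=> q p r /asboolP[k kE] /asboolP[l lE]; apply/asboolP.
exists (q.1 + q.2 + k + l).
by rewrite [LHS](AC (2*4) ((1*4*5)*(3*2*6)))/= kE lE
  (AC (3*3) ((4*2)*(1*5*3*6))).
Qed.

Canonical grothendieck_equiv := EquivRel grothendieck_rel
  grothendieck_rel_refl grothendieck_rel_sym grothendieck_rel_trans.

End Grothendieck.

(* Grothendieck group of a commutative monoid M: the class of (p, q) is the
   formal difference p - q. *)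
Definition grothendieck (M : nmodType) : Type :=
  {eq_quot (@grothendieck_equiv M)}.

HB.instance Definition _ (M : nmodType) := Quotient.on (grothendieck M).
HB.instance Definition _ (M : nmodType) := Choice.on (grothendieck M).

Section GrothendieckTheory.
Context {M : nmodType}.
Implicit Types (a b c d : M) (x y z : grothendieck M).

Definition fdiff a b : grothendieck M := \pi_(grothendieck M) (a, b).

Lemma fdiffP a b c d :
  fdiff a b = fdiff c d <-> exists k, a + d + k = c + b + k.
Proof.
by split=> [/eqmodP/asboolP//|k]; apply/eqmodP/asboolP.
Qed.

Lemma fdiff_repr x : fdiff (repr x).1 (repr x).2 = x.
Proof. by rewrite /fdiff -surjective_pairing reprK. Qed.

Definition fdiff_add x y :=
  fdiff ((repr x).1 + (repr y).1) ((repr x).2 + (repr y).2).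
Definition fdiff_opp x := fdiff (repr x).2 (repr x).1.

Lemma fdiffD a b c d : fdiff_add (fdiff a b) (fdiff c d) = fdiff (a + c) (b + d).
Proof.
rewrite /fdiff_add.
move: (fdiff_repr (fdiff a b)) (fdiff_repr (fdiff c d)).
move: (repr _) (repr _) => [x1 x2] [y1 y2] /= /fdiffP[k kE] /fdiffP[l lE].
apply/fdiffP; exists (k + l).
by rewrite [LHS](AC (2*2*2) ((1*3*5)*(2*4*6)))/= kE lE
  (AC (3*3) ((1*4)*(2*5)*(3*6))).
Qed.

Lemma fdiffN a b : fdiff_opp (fdiff a b) = fdiff b a.
Proof.
rewrite /fdiff_opp; move: (fdiff_repr (fdiff a b)).
move: (repr _) => [x1 x2] /= /fdiffP[k kE]; apply/fdiffP; exists k.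
by rewrite [x2 + a]addrC -kE [b + _]addrC.
Qed.

Lemma fdiff_addA : associative fdiff_add.
Proof.
move=> x y z; rewrite -(fdiff_repr x) -(fdiff_repr y) -(fdiff_repr z).
by rewrite !fdiffD !addrA.
Qed.

Lemma fdiff_addC : commutative fdiff_add.
Proof.
move=> x y; rewrite -(fdiff_repr x) -(fdiff_repr y) !fdiffD.
by congr fdiff; exact: addrC.
Qed.

Lemma fdiff_add0 : left_id (fdiff 0 0) fdiff_add.
Proof. by move=> x; rewrite -(fdiff_repr x) fdiffD !add0r. Qed.

Lemma fdiff_addN : left_inverse (fdiff 0 0) fdiff_opp fdiff_add.
Proof.
move=> x; rewrite -(fdiff_repr x) fdiffN fdiffD; apply/fdiffP; exists 0.
by rewrite !addr0 add0r addrC.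
Qed.

HB.instance Definition _ := GRing.isZmodule.Build (grothendieck M)
  fdiff_addA fdiff_addC fdiff_add0 fdiff_addN.

End GrothendieckTheory.

(* d(x, A); meaningful for nonempty A only, since inf set0 = 0. *)
Definition setdist {R : realType} {X : metricType R} (A : set X) (x : X) : R :=
  inf [set mdist x a | a in A].

(* The last two fields are the standing assumption that makes the 1-strengthened
   metric on X / A well-defined and separated. *)
Record metricPair (R : realType) := MetricPair {
  mp_space :> metricType R ;
  mp_sub : set mp_space ;
  mp_sub_neq0 : mp_sub !=set0 ;
  mp_sub_sep : forall x, ~ mp_sub x -> 0 < setdist mp_sub x }.

Section Strengthened.
Context {R : realType} {P : metricPair R}.
Local Notation A := (@mp_sub R P).
Implicit Types (x y z a b : P).

Definition strengthened x y : R :=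
  Num.min (mdist x y) (setdist A x + setdist A y).

Lemma has_inf_setdist x : has_inf [set mdist x a | a in A].
Proof.
split; first by have [a Aa] := mp_sub_neq0 P; exists (mdist x a), a.
by exists 0 => _ [a _ <-]; exact: mdist_ge0.
Qed.

Lemma setdist_ge0 x : 0 <= setdist A x.
Proof.
apply: lb_le_inf; first by have [] := has_inf_setdist x.
by move=> _ [a _ <-]; exact: mdist_ge0.
Qed.

Lemma setdist_le x a : A a -> setdist A x <= mdist x a.
Proof. by move=> Aa; apply: ge_inf; [have [] := has_inf_setdist x|exists a]. Qed.

Lemma setdist_eq0 a : A a -> setdist A a = 0.
Proof.
by move=> Aa; apply/le_anti; rewrite setdist_ge0 -(mdistxx a) setdist_le.
Qed.

Lemma setdist_lip x y : setdist A x <= mdist x y + setdist A y.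
Proof.
rewrite -lerBlDl; apply: lb_le_inf; first by have [] := has_inf_setdist y.
move=> _ [a Aa <-]; rewrite lerBlDl (le_trans (setdist_le x Aa))//.
exact: metric_triangle.
Qed.

Lemma strengthened_ge0 x y : 0 <= strengthened x y.
Proof. by rewrite le_min mdist_ge0 addr_ge0 ?setdist_ge0. Qed.

Lemma strengthenedxx x : strengthened x x = 0.
Proof. by rewrite /strengthened min_l mdistxx// addr_ge0 ?setdist_ge0. Qed.

Lemma strengthenedC x y : strengthened x y = strengthened y x.
Proof. by rewrite /strengthened metric_sym addrC. Qed.

Lemma strengthened_triangle y x z :
  strengthened x z <= strengthened x y + strengthened y z.
Proof.
have := setdist_lip x y; have := setdist_lip z y.
have := metric_triangle x y z; have := setdist_ge0 y.
rewrite /strengthened (metric_sym z y).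
set u := mdist x y; set v := mdist y z; set w := mdist x z => *.
by rewrite ge_min; apply/orP; rewrite /Num.min; case: ifP => _; case: ifP => _;
  [left|right|right|right]; lra.
Qed.

Lemma strengthened_sub x a : A a -> strengthened x a = setdist A x.
Proof.
by move=> Aa; rewrite /strengthened (setdist_eq0 Aa) addr0 min_r// setdist_le.
Qed.

Lemma strengthened_eq0 x y : strengthened x y = 0 -> x = y \/ A x /\ A y.
Proof.
rewrite /strengthened /Num.min; case: ifP => _; first by left; exact: mdist_positivity.
move/eqP; rewrite paddr_eq0 ?setdist_ge0// => /andP[/eqP x0 /eqP y0]; right.
by split; apply: contrapT => /mp_sub_sep; rewrite ?x0 ?y0 ltxx.
Qed.

End Strengthened.

Section Collapse.
Context {R : realType} {P : metricPair R}.
Local Notation A := (@mp_sub R P).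
Implicit Types x y z : P.

Definition collapse_rel x y : bool := (x == y) || `[< A x /\ A y >].

Lemma collapse_rel_refl : reflexive collapse_rel.
Proof. by move=> x; rewrite /collapse_rel eqxx. Qed.

Lemma collapse_rel_sym : symmetric collapse_rel.
Proof.
move=> x y; rewrite /collapse_rel eq_sym; congr (_ || _).
by apply/asboolP/asboolP => -[].
Qed.

Lemma collapse_rel_trans : transitive collapse_rel.
Proof.
move=> y x z; rewrite /collapse_rel => /predU1P[->//|/asboolP[Ax Ay]].
move=> /predU1P[<-|/asboolP[_ Az]]; apply/orP; right; exact/asboolP.
Qed.

Canonical collapse_equiv := EquivRel collapse_rel
  collapse_rel_refl collapse_rel_sym collapse_rel_trans.

End Collapse.

(* X / A, where A is collapsed to a single point [A]; [A] is the distinguished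
   point of the pointed structure below. *)
Definition collapse {R : realType} (P : metricPair R) : Type :=
  {eq_quot (@collapse_equiv R P)}.

Section CollapseMetric.
Context {R : realType} {P : metricPair R}.
Local Notation A := (@mp_sub R P).
Implicit Types (x y : P) (u v w : collapse P).

HB.instance Definition _ := Quotient.on (collapse P).
HB.instance Definition _ := Choice.on (collapse P).
HB.instance Definition _ := isPointed.Build (collapse P)
  (\pi_(collapse P) (sval (cid (mp_sub_neq0 P)))).

Definition collapse_dist u v : R := strengthened (repr u) (repr v).

Lemma strengthened_pi0 x y : \pi_(collapse P) x = \pi_(collapse P) y ->
  strengthened x y = 0.
Proof.
move=> /eqmodP/predU1P[->|/asboolP[Ax Ay]]; first exact: strengthenedxx.
by rewrite strengthened_sub// setdist_eq0.
Qed.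

Lemma strengthened_congr x x' y :
  strengthened x x' = 0 -> strengthened x y = strengthened x' y.
Proof.
move=> h; apply/le_anti/andP; split.
  by rewrite (le_trans (strengthened_triangle x' _ _))// h add0r.
by rewrite (le_trans (strengthened_triangle x _ _))// strengthenedC h add0r.
Qed.

Lemma collapse_distE x y :
  collapse_dist (\pi_(collapse P) x) (\pi_(collapse P) y) = strengthened x y.
Proof.
have h z : strengthened (repr (\pi_(collapse P) z)) z = 0.
  by apply: strengthened_pi0; rewrite reprK.
rewrite /collapse_dist (strengthened_congr _ (h x)) strengthenedC.
by rewrite (strengthened_congr _ (h y)); exact: strengthenedC.
Qed.

Lemma collapse_distxx u : collapse_dist u u = 0.
Proof. exact: strengthenedxx. Qed.

Lemma collapse_dist_eq0 u v : collapse_dist u v = 0 -> u = v.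
Proof.
move=> /strengthened_eq0 h; rewrite -(reprK u) -(reprK v); apply/eqmodP.
by apply/orP; case: h => [->|h]; [left|right; apply/asboolP].
Qed.

Lemma collapse_distC u v : collapse_dist u v = collapse_dist v u.
Proof. exact: strengthenedC. Qed.

Lemma collapse_dist_triangle v u w :
  collapse_dist u w <= collapse_dist u v + collapse_dist v w.
Proof. exact: strengthened_triangle. Qed.

HB.instance Definition _ := isMetric.Build R (collapse P)
  collapse_distxx collapse_dist_eq0 collapse_distC collapse_dist_triangle.

Lemma mdist_collapse x y :
  mdist (\pi_(collapse P) x) (\pi_(collapse P) y) = strengthened x y.
Proof. exact: collapse_distE. Qed.

Lemma mdist_collapse_point x :
  mdist (\pi_(collapse P) x) (point : collapse P) = setdist A x.
Proof.
by rewrite mdist_collapse; case: cid => a Aa /=; rewrite strengthened_sub.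
Qed.

End CollapseMetric.

Local Open Scope mset_scope.

Section Diagram.
Context {R : realType} {P : metricPair R}.
Local Notation A := (@mp_sub R P).
Implicit Types (x y z : P) (s t : {mset P}).

Definition supported s : Prop := {in s, forall x, A x}.

(* The monoid congruence on D(X) = {mset P} whose quotient is D(X) / D(A). *)
Definition diagram_rel s t : bool :=
  `[< exists a b, [/\ supported a, supported b & msetD s a = msetD t b] >].

Lemma diagram_relP s t :
  reflect (forall x, ~ A x -> s x = t x) (diagram_rel s t).
Proof.
rewrite /diagram_rel.
apply: (iffP (asboolP _)) => [[a [b [Aa Ab /msetP st]]] x nAx|st].
  have a0 : a x = 0%N by apply/mset_eq0P/negP => /Aa.
  have b0 : b x = 0%N by apply/mset_eq0P/negP => /Ab.
  by have := st x; rewrite !(mset0E, msetE2) a0 b0 !addn0.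
pose inA (u : {mset P}) := seq_mset [seq x <- u | `[< A x >]].
have inAP u : supported (inA u).
  by move=> x; rewrite (perm_mem (perm_eq_seq_mset _)) mem_filter => /andP[/asboolP].
have inAE u x : inA u x = (`[< A x >] * u x)%N.
  rewrite mset_seqE count_filter; case: asboolP => [Ax|nAx].
    rewrite mul1n -count_mem_mset; apply: eq_count => y /=.
    by case: eqP => //= ->; exact/asboolP.
  rewrite mul0n; apply/eqP; rewrite -leqn0 leqNgt -has_count.
  by apply/hasPn => y _ /=; case: eqP => //= ->; exact/asboolP.
exists (inA t), (inA s); split; [exact: inAP..|].
apply/msetP => x; rewrite !(mset0E, msetE2) !inAE; case: asboolP => [_|nAx].
  by rewrite !mul1n addnC.
by rewrite !mul0n !addn0 st.
Qed.

Lemma diagram_rel_refl : reflexive diagram_rel.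
Proof. by move=> s; apply/diagram_relP. Qed.

Lemma diagram_rel_sym : symmetric diagram_rel.
Proof.
by move=> s t; apply/diagram_relP/diagram_relP => st x /st.
Qed.

Lemma diagram_rel_trans : transitive diagram_rel.
Proof.
move=> t s u /diagram_relP st /diagram_relP tu; apply/diagram_relP => x nAx.
by rewrite st// tu.
Qed.

Canonical diagram_equiv := EquivRel diagram_rel
  diagram_rel_refl diagram_rel_sym diagram_rel_trans.

End Diagram.

(* D(X, A) *)
Definition diagram {R : realType} (P : metricPair R) : Type :=
  {eq_quot (@diagram_equiv R P)}.

Section DiagramMonoid.
Context {R : realType} {P : metricPair R}.
Local Notation A := (@mp_sub R P).
Implicit Types (s t : {mset P}) (f g h : diagram P).

HB.instance Definition _ := Quotient.on (diagram P).
HB.instance Definition _ := Choice.on (diagram P).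

Definition diagram_add f g : diagram P :=
  \pi_(diagram P) (msetD (repr f) (repr g)).

Lemma diagramP s t : \pi_(diagram P) s = \pi_(diagram P) t <->
  (forall x, ~ A x -> s x = t x).
Proof.
by split=> [/eqmodP/diagram_relP//|st]; apply/eqmodP/diagram_relP.
Qed.

Lemma diagramD s t : diagram_add (\pi_(diagram P) s) (\pi_(diagram P) t) =
  \pi_(diagram P) (msetD s t).
Proof.
rewrite /diagram_add.
have /diagramP sE := reprK (\pi_(diagram P) s).
have /diagramP tE := reprK (\pi_(diagram P) t).
by apply/diagramP => x nAx; rewrite !(mset0E, msetE2) sE// tE.
Qed.

Lemma diagram_addA : associative diagram_add.
Proof.
move=> f g h; rewrite -(reprK f) -(reprK g) -(reprK h).
rewrite (diagramD (repr g)) (diagramD (repr f)) (diagramD (repr f)).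
by rewrite diagramD msetDA.
Qed.

Lemma diagram_addC : commutative diagram_add.
Proof.
by move=> f g; rewrite -(reprK f) -(reprK g) !diagramD msetDC.
Qed.

Lemma diagram_add0 : left_id (\pi_(diagram P) mset0) diagram_add.
Proof. by move=> f; rewrite -(reprK f) diagramD mset0D. Qed.

HB.instance Definition _ := GRing.isNmodule.Build (diagram P)
  diagram_addA diagram_addC diagram_add0.

End DiagramMonoid.

Section Wasserstein.
Context {R : realType} {P : metricPair R}.
Local Notation A := (@mp_sub R P).
Implicit Types (x y z : P) (f g h : diagram P).

(* The marginals of m, read in D(X, A), are f and g. *)
Definition is_matching f g (m : {mset (P * P)}) : Prop :=
  \pi_(diagram P) (seq_mset [seq p.1 | p <- m]) = f /\
  \pi_(diagram P) (seq_mset [seq p.2 | p <- m]) = g.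

Definition matching_cost (m : {mset (P * P)}) : R :=
  \sum_(p <- m) strengthened p.1 p.2.

(* An infimum of a nonempty set of nonnegative reals, see has_inf_matching. *)
Definition W1 f g : R := inf [set matching_cost m | m in is_matching f g].

Local Notation cls s := (\pi_(diagram P) (seq_mset s)).
Implicit Types (s t u v : seq P) (r q : seq (P * P)).

Let cost r : R := \sum_(p <- r) strengthened p.1 p.2.

Let matches f g r := cls [seq p.1 | p <- r] = f /\ cls [seq p.2 | p <- r] = g.

Let clsP s t :
  cls s = cls t <-> (forall x, ~ A x -> count_mem x s = count_mem x t).
Proof.
by rewrite diagramP; split=> st x /st; rewrite !mset_seqE.
Qed.

Let cls_perm s t : perm_eq s t -> cls s = cls t.
Proof. by move=> /eq_seq_msetP ->. Qed.

Let cls_cat s t : cls (s ++ t) = cls s + cls t.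
Proof.
rewrite /GRing.add /= diagramD; congr (\pi _); apply/msetP => x.
by rewrite (mset0E, msetE2) !mset_seqE count_cat.
Qed.

Let cls_cons x s : cls (x :: s) = cls [:: x] + cls s.
Proof. by rewrite -cls_cat. Qed.

Let cls_sub x : A x -> cls [:: x] = 0.
Proof.
move=> Ax; apply/diagramP => y nAy; rewrite mset_seqE /= (mset0E, msetE2) addn0.
by case: eqP => // xy; move: nAy; rewrite -xy.
Qed.

Let cls_ind s : (forall x, x \in s -> A x) -> cls s = 0.
Proof.
elim: s => [_|x s IH h].
  by apply/diagramP => x _; rewrite mset_seqE (mset0E, msetE2).
rewrite cls_cons cls_sub; last by apply: h; rewrite mem_head.
by rewrite add0r IH// => y ys; apply: h; rewrite in_cons ys orbT.
Qed.

Let cls_repr f : cls (repr f : {mset P}) = f.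
Proof. by rewrite seq_mset_id reprK. Qed.

Let cls_addI f g h : f + g = f + h -> g = h.
Proof.
rewrite -(cls_repr f) -(cls_repr g) -(cls_repr h) -!cls_cat => /clsP fgh.
apply/clsP => x /fgh; rewrite !count_cat; exact: addnI.
Qed.

Let cost_ge0 r : 0 <= cost r.
Proof. by apply: sumr_ge0 => p _; exact: strengthened_ge0. Qed.

Let cost_perm r q : perm_eq r q -> cost r = cost q.
Proof. by move=> rq; exact: perm_big. Qed.

Let cost_cat r q : cost (r ++ q) = cost r + cost q.
Proof. by rewrite /cost big_cat. Qed.

Let matches_perm f g r q : perm_eq r q -> matches f g r -> matches f g q.
Proof.
move=> rq [<- <-]; split; apply: cls_perm; apply: perm_map; by rewrite perm_sym.
Qed.

Let matches_mset f g (m : {mset (P * P)}) : is_matching f g m = matches f g m.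
Proof. by []. Qed.

Let matches_seq f g r : matches f g r -> is_matching f g (seq_mset r).
Proof. by apply: matches_perm; rewrite perm_sym perm_eq_seq_mset. Qed.

Let cost_seq r : matching_cost (seq_mset r) = cost r.
Proof. exact/cost_perm/perm_eq_seq_mset. Qed.

Lemma matching_cost_ge0 m : 0 <= matching_cost m.
Proof. exact: cost_ge0. Qed.

Lemma matching_ex f g : exists m, is_matching f g m.
Proof.
have [a Aa] := mp_sub_neq0 P.
pose r := [seq (x, a) | x <- (repr f : {mset P})] ++
          [seq (a, y) | y <- (repr g : {mset P})].
exists (seq_mset r); apply: matches_seq; split.
  rewrite map_cat cls_cat -!map_comp map_id cls_repr cls_ind ?addr0//.
  by move=> x /mapP[y _ ->].
rewrite map_cat cls_cat -!map_comp map_id cls_repr cls_ind ?add0r//.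
by move=> x /mapP[y _ ->].
Qed.

Lemma has_inf_matching f g :
  has_inf [set matching_cost m | m in is_matching f g].
Proof.
split; first by have [m mm] := matching_ex f g; exists (matching_cost m), m.
by exists 0 => _ [m _ <-]; exact: matching_cost_ge0.
Qed.

Lemma W1_ge0 f g : 0 <= W1 f g.
Proof.
apply: lb_le_inf; first by have [] := has_inf_matching f g.
by move=> _ [m _ <-]; exact: matching_cost_ge0.
Qed.

Let W1_le f g r : matches f g r -> W1 f g <= cost r.
Proof.
move=> fgr; rewrite -cost_seq; apply: ge_inf.
  by have [] := has_inf_matching f g.
by exists (seq_mset r) => //; exact: matches_seq.
Qed.

Let W1_lb f g (c : R) : (forall r, matches f g r -> c <= cost r) -> c <= W1 f g.
Proof.
move=> h; apply: lb_le_inf; first by have [] := has_inf_matching f g.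
by move=> _ [m fgm <-]; exact: h.
Qed.

Let W1_lt f g (e : R) : W1 f g < e -> exists2 r, matches f g r & cost r < e.
Proof.
move=> We; apply: contrapT => h; move: We; apply/negP; rewrite -leNgt.
by apply: W1_lb => r fgr; rewrite leNgt; apply/negP => re; apply: h; exists r.
Qed.

Let diag s := [seq (x, x) | x <- s].

Let diag1 s : [seq p.1 | p <- diag s] = s.
Proof. by rewrite /diag -map_comp map_id. Qed.

Let diag2 s : [seq p.2 | p <- diag s] = s.
Proof. by rewrite /diag -map_comp map_id. Qed.

Let cost_diag s : cost (diag s) = 0.
Proof. by rewrite /cost big_map big1// => x _; rewrite strengthenedxx. Qed.

Lemma W1xx f : W1 f f = 0.
Proof.
apply/le_anti; rewrite W1_ge0 andbT -(cost_diag (repr f : {mset P})).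
by apply: W1_le; split; rewrite ?diag1 ?diag2 cls_repr.
Qed.

Let W1_sym_le f g : W1 f g <= W1 g f.
Proof.
apply: W1_lb => r [r1 r2].
have -> : cost r = cost [seq (p.2, p.1) | p <- r].
  by rewrite /cost big_map; apply: eq_bigr => p _; rewrite strengthenedC.
by apply: W1_le; split; rewrite -map_comp.
Qed.

Lemma W1C f g : W1 f g = W1 g f.
Proof. by apply/le_anti; rewrite !W1_sym_le. Qed.

Let glue r q : [seq p.2 | p <- r] = [seq p.1 | p <- q] -> exists k,
  [/\ [seq p.1 | p <- k] = [seq p.1 | p <- r],
      [seq p.2 | p <- k] = [seq p.2 | p <- q] & cost k <= cost r + cost q].
Proof.
elim: r q => [|[x y] r IH] [|[y' z] q] //=.
  by move=> _; exists [::]; split; rewrite // /cost !big_nil addr0.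
case=> <- /IH[k [k1 k2 kc]]; exists ((x, z) :: k); split=> /=.
- by rewrite k1.
- by rewrite k2.
- rewrite /cost !big_cons /= addrACA lerD//; exact: strengthened_triangle.
Qed.

Let perm_lift q s : perm_eq s [seq p.1 | p <- q] ->
  exists2 q', perm_eq q' q & [seq p.1 | p <- q'] = s.
Proof.
have [a Aa] := mp_sub_neq0 P.
move=> /(perm_iotaP a)[Is IsE ->]; rewrite size_map in IsE.
exists [seq nth (a, a) q i | i <- Is]; first by apply/(perm_iotaP (a, a)); exists Is.
rewrite -map_comp; apply/eq_in_map => i iIs /=.
by rewrite (nth_map (a, a))//; rewrite (perm_mem IsE) mem_iota in iIs.
Qed.

Let pad s t : cls s = cls t -> exists u v,
  [/\ cls u = 0, cls v = 0 & perm_eq (s ++ u) (t ++ v)].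
Proof.
move=> /eqmodP/asboolP[a [b [Aa Ab ab]]]; exists (a : seq P), (b : seq P).
split; [exact: cls_ind|exact: cls_ind|].
apply/allP => x _ /=; rewrite !count_cat !count_mem_mset.
by have /msetP/(_ x) := ab; rewrite !(mset0E, msetE2) !mset_seqE => ->.
Qed.

Lemma W1_triangle g f h : W1 f h <= W1 f g + W1 g h.
Proof.
rewrite -lerBlDl; apply: W1_lb => q [q1 q2].
rewrite lerBlDl -lerBlDr; apply: W1_lb => r [r1 r2]; rewrite lerBlDr.
have [u [v [u0 v0 uv]]] : exists u v, [/\ cls u = 0, cls v = 0 &
    perm_eq ([seq p.2 | p <- r] ++ u) ([seq p.1 | p <- q] ++ v)].
  by apply: pad; rewrite r2 q1.
rewrite -{1}(diag1 v) -map_cat in uv.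
have [q' q'q q'E] := perm_lift uv.
have [|k [k1 k2 kc]] := @glue (r ++ diag u) q'.
  by rewrite q'E map_cat diag2.
rewrite cost_cat (cost_perm q'q) cost_cat !cost_diag !addr0 in kc.
apply: le_trans kc; apply: W1_le; split.
  by rewrite k1 map_cat diag1 cls_cat u0 addr0.
rewrite k2; have -> : cls [seq p.2 | p <- q'] = cls [seq p.2 | p <- q ++ diag v].
  exact/cls_perm/perm_map.
by rewrite map_cat diag2 cls_cat v0 addr0.
Qed.

Let W1D_le f g h : W1 (f + h) (g + h) <= W1 f g.
Proof.
apply: W1_lb => r [r1 r2].
rewrite -[leRHS]addr0 -(cost_diag (repr h : {mset P})) -cost_cat.
by apply: W1_le; split; rewrite map_cat cls_cat ?diag1 ?diag2 cls_repr ?r1 ?r2.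
Qed.

Let mem_cls z s f : ~ A z -> cls s = f + cls [:: z] -> z \in s.
Proof.
move=> nAz; rewrite -(cls_repr f) -cls_cat => /clsP/(_ _ nAz).
rewrite count_cat /= eqxx addn1 => sz; rewrite -has_pred1 has_count sz.
by rewrite ltnS.
Qed.

Let W1D1 f g z : W1 f g <= W1 (f + cls [:: z]) (g + cls [:: z]).
Proof.
have [Az|nAz] := pselect (A z); first by rewrite cls_sub ?addr0.
apply: W1_lb => r [r1 r2].
have /mapP[[z' v] /= zvr zz'] := mem_cls nAz r1; rewrite -zz' {z' zz'} in zvr.
have /cost_perm -> := perm_to_rem zvr.
have /(perm_map fst) /cls_perm := perm_to_rem zvr; rewrite /= cls_cons.
have /(perm_map snd) /cls_perm := perm_to_rem zvr; rewrite /= cls_cons.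
move: (rem (z, v) r) => {zvr} q; rewrite -[map fst r]/[seq p.1 | p <- r].
rewrite -[map snd r]/[seq p.2 | p <- r] r1 r2 => q2 q1 {r r1 r2}.
have {}q1 : cls [seq p.1 | p <- q] = f.
  by apply: (@cls_addI (cls [:: z])); rewrite -q1 addrC.
rewrite /cost big_cons /= -/(cost q).
have [vz|/eqP vz] := eqVneq v z.
  subst v; rewrite strengthenedxx add0r; apply: W1_le; split => //.
  by apply: (@cls_addI (cls [:: z])); rewrite -q2 addrC.
have /mapP[[w z'] /= wzq zz'] : z \in [seq p.2 | p <- q].
  move: q2; rewrite -(cls_repr g) -!cls_cat => /clsP/(_ _ nAz).
  rewrite !count_cat /= eqxx; case: (v =P z) => // _; rewrite add0n addn1.
  by rewrite -has_pred1 has_count => <-.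
rewrite -zz' {z' zz'} in wzq.
have /cost_perm -> := perm_to_rem wzq.
have /(perm_map fst) /cls_perm := perm_to_rem wzq; rewrite /= cls_cons.
have /(perm_map snd) /cls_perm := perm_to_rem wzq; rewrite /= cls_cons.
move: (rem (w, z) q) => {wzq} k k2 k1.
rewrite /cost big_cons /= addrA -/(cost k).
have -> : strengthened z v + strengthened w z =
  strengthened w z + strengthened z v by rewrite addrC.
apply: (@le_trans _ _ (cost ((w, v) :: k))); last first.
  by rewrite /cost big_cons lerD2r; exact: strengthened_triangle.
apply: W1_le; split; first by rewrite /= cls_cons -q1 -k1.
apply: (@cls_addI (cls [:: z])); rewrite /= (cls_cons v).
by rewrite [RHS]addrC q2 addrCA; congr (_ + _); exact: esym.
Qed.

Lemma W1D f g h : W1 (f + h) (g + h) = W1 f g.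
Proof.
apply/le_anti; rewrite W1D_le /= -(cls_repr h).
elim: (repr h : seq P) f g => [|z s IH] f g; first by rewrite cls_ind ?addr0.
by rewrite cls_cons !addrA (le_trans (W1D1 f g z)).
Qed.

Let pos_lb (l : seq (P * P)) : exists2 e : R, 0 < e &
  forall p, p \in l -> strengthened p.1 p.2 < e -> strengthened p.1 p.2 = 0.
Proof.
elim: l => [|p l [e e0 h]]; first by exists 1.
have [p0|p0] := eqVneq (strengthened p.1 p.2) 0.
  by exists e => // q; rewrite in_cons => /predU1P[->//|/h].
exists (Num.min e (strengthened p.1 p.2)).
  by rewrite lt_min e0 lt_neqAle eq_sym p0 strengthened_ge0.
move=> q; rewrite in_cons lt_min => /predU1P[->|/h{}h] /andP[+ +].
  by rewrite ltxx.
by move=> /h.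
Qed.

Lemma W1_eq0 f g : W1 f g = 0 -> f = g.
Proof.
have [a Aa] := mp_sub_neq0 P => W0.
pose s := repr f : seq P; pose t := repr g : seq P.
have [e e0 he] := pos_lb [seq (x, y) | x <- a :: s, y <- a :: t].
have [r [r1 r2] re] : exists2 r, matches f g r & cost r < e.
  by apply: W1_lt; rewrite W0.
rewrite -r1 -r2.
have rs p : p \in r -> ~ A p.1 -> p.1 \in s.
  move=> pr nA; rewrite -has_pred1 has_count.
  move: r1; rewrite -(cls_repr f) => /clsP/(_ _ nA) <-.
  by rewrite -has_count has_pred1 map_f.
have rt p : p \in r -> ~ A p.2 -> p.2 \in t.
  move=> pr nA; rewrite -has_pred1 has_count.
  move: r2; rewrite -(cls_repr g) => /clsP/(_ _ nA) <-.
  by rewrite -has_count has_pred1 map_f.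
have r0 p : p \in r -> strengthened p.1 p.2 = 0.
  move=> pr.
  have pe : strengthened p.1 p.2 < e.
    rewrite (le_lt_trans _ re)// /cost (perm_big _ (perm_to_rem pr)) big_cons /=.
    by rewrite lerDl; exact: cost_ge0.
  pose c x := if `[< A x >] then a else x.
  have c0 x : strengthened x (c x) = 0.
    rewrite /c; case: asboolP => [Ax|_]; last exact: strengthenedxx.
    by rewrite strengthened_sub// setdist_eq0.
  have E : strengthened p.1 p.2 = strengthened (c p.1) (c p.2).
    rewrite (strengthened_congr _ (c0 p.1)) strengthenedC.
    by rewrite (strengthened_congr _ (c0 p.2)) strengthenedC.
  rewrite E; apply: (he (c p.1, c p.2)); last by rewrite -E.
  apply: allpairs_f; rewrite in_cons /c; case: asboolP => h; rewrite ?eqxx//.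
    by rewrite rs ?orbT.
  by rewrite rt ?orbT.
elim: r r0 {r1 r2 re rs rt} => [//|p r IH] h /=.
rewrite (cls_cons p.1) (cls_cons p.2) IH; last by move=> q qr; apply: h; rewrite in_cons qr orbT.
congr (_ + _).
have /strengthened_eq0[->//|[A1 A2]] := h p (mem_head _ _).
by rewrite !cls_sub.
Qed.

End Wasserstein.

(* K(X, A) *)
Definition virtual_diagram {R : realType} (P : metricPair R) : Type :=
  grothendieck (diagram P).

Section GrothendieckMetric.
Context {R : realType} {P : metricPair R}.
Implicit Types (f g h k : diagram P) (x y z : virtual_diagram P).

HB.instance Definition _ := GRing.Zmodule.on (virtual_diagram P).
HB.instance Definition _ := Quotient.on (virtual_diagram P).

(* Computed on representatives; grothendieck_distE shows that the choice is
   irrelevant. *)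
Definition grothendieck_dist x y : R :=
  W1 ((repr x).1 + (repr y).2) ((repr y).1 + (repr x).2).

Lemma grothendieck_distE f g h k :
  grothendieck_dist (fdiff f g) (fdiff h k) = W1 (f + k) (h + g).
Proof.
have : fdiff (repr (fdiff f g)).1 (repr (fdiff f g)).2 = fdiff f g.
  exact: fdiff_repr.
have : fdiff (repr (fdiff h k)).1 (repr (fdiff h k)).2 = fdiff h k.
  exact: fdiff_repr.
rewrite /grothendieck_dist.
move: (repr _) (repr _) => [f' g'] [h' k'] /= /fdiffP[m mE] /fdiffP[l lE].
rewrite -(W1D _ _ (g + k + l + m)) -(W1D (f + k) _ (g' + k' + l + m)).
have -> : f' + k' + (g + k + l + m) = f + k + (g' + k' + l + m).
  rewrite [LHS](AC (2*4) ((1*3*5)*(2*4*6)))/= lE.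
  by rewrite (AC (3*3) ((1*5)*(2*4*3*6))).
have -> // : h' + g' + (g + k + l + m) = h + g + (g' + k' + l + m).
rewrite [LHS](AC (2*4) ((1*4*6)*(2*3*5)))/= mE.
by rewrite (AC (3*3) ((1*5)*(4*2*6*3))).
Qed.

Lemma grothendieck_distxx x : grothendieck_dist x x = 0.
Proof. exact: W1xx. Qed.

Lemma grothendieck_dist_eq0 x y : grothendieck_dist x y = 0 -> x = y.
Proof.
move=> /W1_eq0 xy; rewrite -(fdiff_repr x) -(fdiff_repr y).
by apply/fdiffP; exists 0; rewrite xy.
Qed.

Lemma grothendieck_distC x y : grothendieck_dist x y = grothendieck_dist y x.
Proof. exact: W1C. Qed.

Lemma grothendieck_dist_triangle y x z :
  grothendieck_dist x z <= grothendieck_dist x y + grothendieck_dist y z.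
Proof.
rewrite /grothendieck_dist.
move: (repr x) (repr y) (repr z) => [x1 x2] [y1 y2] [z1 z2] /=.
rewrite -(W1D (x1 + z2) _ y2) -(W1D (x1 + y2) _ z2) -(W1D (y1 + z2) _ x2).
have -> : z1 + x2 + y2 = z1 + y2 + x2 by rewrite addrAC.
have -> : x1 + z2 + y2 = x1 + y2 + z2 by rewrite addrAC.
have -> : y1 + x2 + z2 = y1 + z2 + x2 by rewrite addrAC.
exact: W1_triangle.
Qed.

HB.instance Definition _ := isMetric.Build R (virtual_diagram P)
  grothendieck_distxx grothendieck_dist_eq0 grothendieck_distC
  grothendieck_dist_triangle.

Lemma mdist_fdiff f g h k :
  mdist (fdiff f g : virtual_diagram P) (fdiff h k) = W1 (f + k) (h + g).
Proof. exact: grothendieck_distE. Qed.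

End GrothendieckMetric.

Definition discrete_space (T : topologicalType) : Prop :=
  forall x : T, open [set x].

Definition uniformly_discrete {R : realType} (T : metricType R) : Prop :=
  exists2 e : R, 0 < e & forall u v : T, u != v -> e <= mdist u v.

(* Main.v *)
Require Import Defs.
From mathcomp Require Import all_boot all_order all_algebra.
From mathcomp Require Import finmap multiset.
From mathcomp Require Import all_classical all_reals all_analysis.
From mathcomp Require Import lra.

Import Order.TTheory GRing.Theory Num.Theory.

Local Open Scope classical_set_scope.

(** The only substantial implication is that local compactness forces X / A to
be uniformly discrete.

A function f on X that vanishes on A and is 1-Lipschitz for d_1 extends
additively to diagrams, and its extension is 1-Lipschitz for W_1
([diagram_sum_W1], the easy half of Kantorovich duality).  Such functions give
lower bounds for W_1, and explicit matchings give upper bounds.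

Let delta = d_1(x, y) > 0.  The matching that pairs x with y n times shows that
n[x] - n[y] is within n * delta of 0.  Conversely, fix v in K(X, A).  When delta
is small compared with the gaps between the finitely many points involved in v and
[A], one of x, y is at distance at least delta / 2 from all of them: two points
that share their nearest point cannot both be closer than delta / 2 to it, and
two different nearest points would be too close to each other.  The tent
function of height delta / 2 at that one of x, y then vanishes on A, on v and
at the other point, so n[x] - n[y] is at distance at least n * delta / 2 from v
([mdist_multiple_far]).

If X / A is not uniformly discrete, take pairs x, y with delta tending to 0
and n with n * delta between e / 4 and e / 2.  These elements lie in the e-ball
around 0, yet each v stays at distance at least e / 8 from all those with
delta small, so they have no cluster point and no neighbourhood of 0 is
compact ([locally_compact_uniformly_discrete]).

In the other direction, if distinct points of X / A are at distance at least e,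
then a matching of cost less than e uses only pairs at distance 0, so distinct
diagrams are at distance at least e and K(X, A) is discrete.  Discreteness
gives back uniform discreteness because x |-> [x] is an isometric embedding,
and discrete spaces are locally compact. *)

(** * Lipschitz functions and lower bounds for W_1 *)

Section Duality.
Set Implicit Arguments.
Unset Strict Implicit.
Local Open Scope ring_scope.
Local Open Scope quotient_scope.
Local Open Scope mset_scope.
Context {R : realType} {P : metricPair R}.
Local Notation A := (@mp_sub R P).
Implicit Types (x y z a : P) (f : P -> R) (g h : diagram P).

(** These are the 1-Lipschitz functions on (X / A, d_1) that are 0 at [A],
pulled back to X. *)
Definition lip_vanishing f :=
  (forall a, A a -> f a = 0) /\ (forall x y, f x - f y <= strengthened x y).

Definition diagram_sum f g : R := \sum_(x <- (repr g : {mset P})) f x.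

Definition diagram_pt x : diagram P := \pi_(diagram P) (seq_mset [:: x]).

Lemma big_seq_mset (T : choiceType) (F : T -> R) (s : seq T) :
  \sum_(x <- seq_mset s) F x = \sum_(x <- s) F x.
Proof. exact/perm_big/perm_eq_seq_mset. Qed.

Lemma big_msetD (T : choiceType) (F : T -> R) (s t : {mset T}) :
  \sum_(x <- msetD s t) F x = \sum_(x <- s) F x + \sum_(x <- t) F x.
Proof.
rewrite -big_cat; apply: perm_big; apply/allP => x _ /=.
by rewrite count_cat !count_mem_mset msetE2.
Qed.

(** Two multisets with the same class differ by points of A, where f is 0, so
the sum over the chosen representative is the sum over any of them. *)
Lemma diagram_sum_pi f (s : {mset P}) : lip_vanishing f ->
  diagram_sum f (\pi_(diagram P) s) = \sum_(x <- s) f x.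
Proof.
move=> [f0 _].
have sum0 (u : {mset P}) : supported u -> \sum_(x <- u) f x = 0.
  by move=> Au; rewrite big_seq big1// => x /Au/f0.
have /eqmodP/asboolP[u [v [Au Av]]] := reprK (\pi_(diagram P) s).
move=> /(congr1 (fun m : {mset P} => \sum_(x <- m) f x)).
by rewrite !big_msetD (sum0 _ Au) (sum0 _ Av) !addr0.
Qed.

Lemma diagram_sumD f g h : lip_vanishing f ->
  diagram_sum f (g + h) = diagram_sum f g + diagram_sum f h.
Proof. by move=> fL; rewrite (diagram_sum_pi _ fL) big_msetD. Qed.

Lemma diagram_sum_pt f x : lip_vanishing f ->
  diagram_sum f (diagram_pt x) = f x.
Proof.
by move=> fL; rewrite (diagram_sum_pi _ fL) big_seq_mset big_seq1.
Qed.

Lemma diagram_sumMn f x n : lip_vanishing f ->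
  diagram_sum f (diagram_pt x *+ n) = f x *+ n.
Proof.
move=> fL; elim: n => [|n IH]; last first.
  by rewrite !mulrS diagram_sumD// IH diagram_sum_pt.
rewrite !mulr0n -[0]/(\pi_(diagram P) mset0) (diagram_sum_pi _ fL).
by rewrite big_seq big1// => y; rewrite in_mset0.
Qed.

(** For a matching m, the difference of the two sums is the sum over (p, q) in m
of f p - f q, and each term is at most the cost of its pair. *)
Lemma diagram_sum_W1 f g h : lip_vanishing f ->
  diagram_sum f g - diagram_sum f h <= W1 g h.
Proof.
move=> fL; apply: lb_le_inf; first by have [] := has_inf_matching g h.
move=> _ [m [<- <-] <-].
rewrite !(diagram_sum_pi _ fL) !big_seq_mset !big_map -sumrB.
by apply: ler_sum => p _; exact: fL.2.
Qed.

Lemma lip_vanishing_tent x (c : R) :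
  (forall a, A a -> c <= strengthened a x) ->
  lip_vanishing (fun z => Num.max 0 (c - strengthened z x)).
Proof.
move=> cA; split=> [a /cA h|y z]; first by rewrite max_l// subr_le0.
have := strengthened_triangle z y x; have := strengthened_triangle y z x.
rewrite (strengthenedC z y) /Num.max; have := strengthened_ge0 y z.
by case: ifP; case: ifP; lra.
Qed.

(** Matching x and y to A instead of to each other brings no gain, as d_1
already takes that detour into account.  The witness is the distance to y,
normalized to vanish at [A]. *)
Lemma W1_pt_ge x y : strengthened x y <= W1 (diagram_pt x) (diagram_pt y).
Proof.
have [b Ab] := mp_sub_neq0 P.
(* Here b stands for [A]. *)
pose f z := strengthened z y - strengthened b y.
have fL : lip_vanishing f.
  split=> [a Aa|z w]; rewrite /f; last first.
    by have := strengthened_triangle w z y; lra.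
  by rewrite ![strengthened _ y]strengthenedC !strengthened_sub// subrr.
have := diagram_sum_W1 (diagram_pt x) (diagram_pt y) fL.
by rewrite !diagram_sum_pt// /f strengthenedxx; apply: le_trans; lra.
Qed.

Lemma W1_pt_le x y : W1 (diagram_pt x) (diagram_pt y) <= strengthened x y.
Proof.
apply: ge_inf.
  by have [] := has_inf_matching (diagram_pt x) (diagram_pt y).
exists (seq_mset [:: (x, y)]).
  split; congr (\pi _); apply/eq_seq_msetP;
  exact: (perm_map _ (perm_eq_seq_mset _)).
by rewrite /matching_cost big_seq_mset big_seq1.
Qed.

Lemma W1_ptMn_le x y n :
  W1 (diagram_pt x *+ n) (diagram_pt y *+ n) <= strengthened x y *+ n.
Proof.
elim: n => [|n IH]; first by rewrite !mulr0n W1xx.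
rewrite !mulrS.
rewrite (le_trans (W1_triangle (diagram_pt y + diagram_pt x *+ n) _ _))//.
by rewrite W1D ![diagram_pt y + _]addrC W1D lerD// W1_pt_le.
Qed.

(** Representatives in X of the same point of X / A are at distance 0 and may
be distinct, hence a conclusion in terms of the distance. *)
Lemma strengthened_gap (s : seq P) : exists2 e : R, 0 < e &
  {in s &, forall p q, strengthened p q < e -> strengthened p q = 0}.
Proof.
suff [e e0 he] : exists2 e : R, 0 < e & forall d,
    d \in [seq strengthened p q | p <- s, q <- s] -> d < e -> d <= 0.
  exists e => // p q ps qs pqe; apply/le_anti; rewrite strengthened_ge0 andbT.
  by apply: he pqe; exact: allpairs_f.
elim: [seq _ | _ <- s, _ <- s] => [|d l [e e0 he]]; first by exists 1.
have [d0|d0] := leP d 0.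
  by exists e => // d'; rewrite inE => /predU1P[->|/he].
exists (Num.min e d) => [|d']; first by rewrite lt_min e0.
rewrite inE lt_min => /predU1P[->|/he he'] /andP[]; last by move=> /he'.
by rewrite ltxx.
Qed.

(** Otherwise x has some p, and y some q, within half of their distance; then
p and q are closer than the gap of s, so they coincide in X / A and the path
from x to y through them is too short. *)
Lemma half_far (s : seq P) : exists2 e : R, 0 < e &
  forall x y, 0 < strengthened x y < e ->
    {in s, forall p, strengthened x y / 2 <= strengthened p x} \/
    {in s, forall p, strengthened x y / 2 <= strengthened p y}.
Proof.
have [e e0 he] := strengthened_gap s.
exists (e / 2) => [|x y /andP[xy0 xye]]; first by lra.
have [|/existsNP[p /not_implyP[ps /negP]]] :=
  pselect {in s, forall p, strengthened x y / 2 <= strengthened p x}.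
  by left.
rewrite -ltNge => px; right => q qs.
rewrite leNgt; apply/negP => qy.
have pq : strengthened p q = 0.
  apply: he => //; have := strengthened_triangle x p q.
  by have := strengthened_triangle y x q; rewrite (strengthenedC y q); lra.
have := strengthened_triangle p x y; have := strengthened_triangle q p y.
by rewrite (strengthenedC x p); lra.
Qed.

Lemma diagram_sum0 f g : {in (repr g : {mset P}), forall x, f x = 0} ->
  diagram_sum f g = 0.
Proof. by move=> f0; rewrite /diagram_sum big_seq big1. Qed.

(** A tent of height half the distance, centred at whichever of x and y is far
from A, g and h, separates the two sides.  The closeness required of x and y
depends only on the points of g and h, not on the multiplicity n. *)
Lemma W1_multiples_far g h : exists2 e : R, 0 < e &
  forall x y n, 0 < strengthened x y < e ->
    strengthened x y / 2 *+ n <=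
      W1 (diagram_pt x *+ n + g) (h + diagram_pt y *+ n).
Proof.
have [b Ab] := mp_sub_neq0 P.
(* The point b of A makes the tent vanish on all of A. *)
have [e e0 he] := half_far (b :: (repr g : {mset P}) ++ (repr h : {mset P})).
exists e => // x y n xye.
set d := strengthened x y in xye *; have d0 : 0 <= d by case/andP: xye => /ltW.
have tent z :
    {in b :: (repr g : {mset P}) ++ (repr h : {mset P}),
      forall p, d / 2 <= strengthened p z} ->
    let f := fun w => Num.max 0 (d / 2 - strengthened w z) in
    [/\ lip_vanishing f, diagram_sum f g = 0, diagram_sum f h = 0,
        f z = d / 2 & forall w, strengthened w z = d -> f w = 0].
  move=> far f.
  have f0 p : p \in b :: (repr g : {mset P}) ++ (repr h : {mset P}) -> f p = 0.
    by move=> /far dp; rewrite /f max_l// subr_le0.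
  split.
  - apply: lip_vanishing_tent => a Aa.
    by rewrite strengthenedC strengthened_sub// -(strengthened_sub _ Ab)
      strengthenedC far// mem_head.
  - by apply: diagram_sum0 => p pg; rewrite f0// inE mem_cat pg orbT.
  - by apply: diagram_sum0 => p ph; rewrite f0// inE mem_cat ph !orbT.
  - by rewrite /f strengthenedxx subr0 max_r//; lra.
  - by move=> w wz; rewrite /f wz max_l//; lra.
case: (he _ _ xye) => /tent [fL fg fh fz fw].
  apply: le_trans (diagram_sum_W1 _ _ fL).
  rewrite !diagram_sumD// fg fh !diagram_sumMn// fz fw.
    by rewrite mul0rn !addr0 subr0.
  by rewrite strengthenedC.
rewrite W1C; apply: le_trans (diagram_sum_W1 _ _ fL).
by rewrite !diagram_sumD// fg fh !diagram_sumMn// fz fw// mul0rn !add0r subr0.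
Qed.

End Duality.

(** * The topology of the group of virtual diagrams *)

Section Topology.
Set Implicit Arguments.
Unset Strict Implicit.
Local Open Scope ring_scope.
Local Open Scope quotient_scope.
Local Open Scope mset_scope.
Context {R : realType} {P : metricPair R}.
Local Notation K := (virtual_diagram P).
Implicit Types (x y : P).

Definition multiple_diff x y n : K :=
  fdiff (diagram_pt x *+ n) (diagram_pt y *+ n).

Definition vzero : K := fdiff 0 0.

Lemma mdist_multiple0 x y n :
  mdist vzero (multiple_diff x y n) <= strengthened x y *+ n.
Proof.
rewrite metric_sym mdist_fdiff addr0 add0r; exact: W1_ptMn_le.
Qed.

(** The lower bound grows with n * d_1(x, y), however small d_1(x, y) is; so v
is not a cluster point of multiples whose n * d_1(x, y) stays away from 0. *)
Lemma mdist_multiple_far (v : K) : exists2 e : R, 0 < e &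
  forall x y n, 0 < strengthened x y < e ->
    strengthened x y / 2 *+ n <= mdist v (multiple_diff x y n).
Proof.
have [e e0 he] := W1_multiples_far (repr v).2 (repr v).1.
exists e => // x y n /he => /(_ n).
by rewrite -{3}(fdiff_repr v) metric_sym mdist_fdiff.
Qed.

Lemma not_uniformly_discrete : ~ uniformly_discrete (collapse P) ->
  forall e : R, 0 < e -> exists x y, 0 < strengthened x y < e.
Proof.
move=> nud e e0; apply: contrapT => h; apply: nud; exists e => // u v uv.
rewrite leNgt; apply/negP => uve; apply: h; exists (repr u), (repr v).
by rewrite -[strengthened _ _]/(mdist u v) uve mdist_gt0 uv.
Qed.

(** A step at most r / 2 cannot jump over the interval from r / 2 to r. *)
Lemma multiple_between (d r : R) : 0 < d <= r / 2 ->
  exists n, r / 2 <= d *+ n <= r.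
Proof.
move=> /andP[d0 dr].
have r0 : 0 <= r / d by rewrite divr_ge0//; lra.
exists (Num.truncn (r / d)); have /andP[] := Num.Theory.truncn_itv r0.
rewrite ler_pdivlMr// ltr_pdivrMr// -natr1 mulrDl mul1r -mulr_natl.
by move=> *; lra.
Qed.

Lemma locally_compact_uniformly_discrete :
  locally_compact [set: K] -> uniformly_discrete (collapse P).
Proof.
move=> lcK; apply: contrapT => /not_uniformly_discrete small.
have := lcK vzero I; rewrite withinET =>
  -[C /metricType_numDomainType.nbhs_mdistP[e /= e0 eC] [cptC _]].
(* S t consists of the multiples of size comparable to e whose two points are
   closer than t; the filter generated by these sets as t tends to 0 replaces
   a sequence. *)
pose S (t : R) : set K := [set v | exists x y n,
  [/\ 0 < strengthened x y < t, e / 4 <= strengthened x y *+ n <= e / 2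
    & v = multiple_diff x y n]].
pose F := filter_from [set t : R | 0 < t] S.
have FF : ProperFilter F.
  apply: filter_from_proper; last first.
    move=> t /= t0.
    have [|x [y /andP[xy0 ]]] := small (Num.min t (e / 4)).
      by rewrite lt_min t0; lra.
    rewrite lt_min => /andP[xyt xye].
    have [|n nP] := @multiple_between (strengthened x y) (e / 2).
      by rewrite xy0; lra.
    exists (multiple_diff x y n), x, y, n; split=> //; first by rewrite xy0.
    by move: nP; rewrite -mulrA -invfM -natrM.
  apply: filter_from_filter; first by exists 1 => /=.
  move=> t u /= t0 u0; exists (Num.min t u); first by rewrite /= lt_min t0.
  move=> w [x [y [n [/andP[xy0 ]]]]]; rewrite lt_min => /andP[xyt xyu] nP ->.
  by split; exists x, y, n; rewrite xy0.
have FC : F C.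
  exists 1 => //= _ [x [y [n [_ nP ->]]]]; apply: eC.
  by apply: le_lt_trans (mdist_multiple0 _ _ _) _; lra.
have [v [_ clv]] := cptC F FF FC.
have [s s0 far] := mdist_multiple_far v.
have e8 : 0 < e / 8 by lra.
have [_ [[x [y [n [xys nP ->]]]]]] : S s `&` [set w | mdist v w < e / 8] !=set0.
  apply: clv; first by exists s.
  by rewrite -metricType_numDomainType.filter_from_mdist_nbhs; exists (e / 8).
by have := far _ _ n xys; rewrite /= -mulrnAl; lra.
Qed.

(** In a matching of cost less than e each pair costs less than e, hence 0; the
whole matching then costs 0. *)
Lemma uniformly_discrete_W1 : uniformly_discrete (collapse P) ->
  exists2 e : R, 0 < e & forall g h : diagram P, W1 g h < e -> g = h.
Proof.
move=> [e e0 he]; exists e => // g h /inf_lt.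
have [+ _] := has_inf_matching g h.
have strengthened0 x y : strengthened x y < e -> strengthened x y = 0.
  rewrite -mdist_collapse; have [->|/he] := eqVneq (\pi_(collapse P) x) (\pi y).
    by rewrite mdistxx.
  by rewrite leNgt => /negbTE ->.
move=> ne /(_ ne)[_ [m gm <-] me].
have m0 : matching_cost m = 0.
  rewrite /matching_cost big_seq big1// => p pm; apply: strengthened0.
  apply: le_lt_trans me; rewrite /matching_cost (perm_big _ (perm_to_rem pm)).
  by rewrite big_cons lerDl sumr_ge0// => q _; exact: strengthened_ge0.
apply: W1_eq0; apply/le_anti; rewrite W1_ge0 andbT -m0.
by apply: ge_inf; [have [] := has_inf_matching g h|exists m].
Qed.

Lemma uniformly_discrete_discrete :
  uniformly_discrete (collapse P) -> discrete_space K.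
Proof.
move=> /uniformly_discrete_W1[e e0 he] v; rewrite openE => _ ->.
rewrite /interior -metricType_numDomainType.filter_from_mdist_nbhs.
exists e => //= w /he vw.
by apply/esym/mdist_positivity; rewrite -[LHS]/(W1 _ _) vw W1xx.
Qed.

Lemma discrete_uniformly_discrete :
  discrete_space K -> uniformly_discrete (collapse P).
Proof.
move=> /(_ vzero) o0.
have /metricType_numDomainType.nbhs_mdistP[e /= e0 he] :
  nbhs vzero [set vzero] by exact: open_nbhs_nbhs.
exists e => // u v uv; rewrite leNgt; apply/negP => uve.
have /he w0 : mdist vzero (multiple_diff (repr u) (repr v) 1) < e.
  by apply: le_lt_trans (mdist_multiple0 _ _ _) _; rewrite mulr1n.
move: uv; rewrite -mdist_gt0 ltNge => /negP; apply.
rewrite -[mdist u v]/(strengthened _ _) (le_trans (W1_pt_ge _ _))//.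
move: w0 => /(congr1 (mdist vzero)); rewrite mdistxx metric_sym mdist_fdiff.
by rewrite addr0 add0r !mulr1n => ->.
Qed.

Lemma discrete_locally_compact : discrete_space K -> locally_compact [set: K].
Proof.
move=> dK v _; rewrite withinET; exists [set v].
  exact: open_nbhs_nbhs.
split; first exact: compact_set1.
exact/accessible_closed_set1/hausdorff_accessible/metric_hausdorff.
Qed.

End Topology.

Theorem corollary3p3 (R : realType) (P : metricPair R) :
  [<-> locally_compact [set: virtual_diagram P];
       discrete_space (virtual_diagram P);
       uniformly_discrete (collapse P)].
Proof.
tfae.
- by move=> /locally_compact_uniformly_discrete/uniformly_discrete_discrete.
- exact: discrete_uniformly_discrete.
- by move=> /uniformly_discrete_discrete/discrete_locally_compact.
Qed.
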